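(* Consider the random monotone cellular automaton on $\Lambda=\mathbb Z^3$ (with additive group structure) with $m=1$ and either of the following two choices: (a) $\varphi_1(x)=\mathrm{round}\big([x(1,0,0)+x(0,1,0)+x(0,0,1)]/3\big)$ with height function $h(i)=i_1+i_2+i_3$; (b) $\varphi_1(x)=\mathrm{round}\big([x(1,0,-1)+x(0,1,-1)+x(0,0,-1)]/3\big)$ with height function $h(i)=-i_3$. In both cases the critical noise parameter satisfies $p_{\rm c}\geq 1/12000$.
   Context: Setting of random monotone cellular automata: $\Lambda$ is a countable group with unit $0$, written multiplicatively $(i,j)\mapsto ij$ (for $\mathbb Z^3$ this is addition). A height function is a group homomorphism $h:\Lambda\to(\mathbb Z,+)$. A map $\varphi:\{0,1\}^\Lambda\to\{0,1\}$ is local if it depends on finitely many coordinates, and $\Delta(\varphi)$ denotes the smallest set of coordinates on which it depends; it is monotone if $x\le y$ coordinatewise implies $\varphi(x)\le\varphi(y)$. Let $\varphi_0$ be the constant-zero map and $\varphi_1,\dots,\varphi_m$ non-constant local monotone maps with $\Delta(\varphi_k)\subset\{i\in\Lambda:h(i)=1\}$. Let $\mathbf r$ be a probability distribution on $\{1,\dots,m\}$ (here $m=1$, so $\mathbf r$ is trivial), $p\in[0,1]$, and $(\mu(i))_{i\in\Lambda}$ i.i.d. with $\mathbb P[\mu(i)=0]=p$ and $\mathbb P[\mu(i)=k]=(1-p)\mathbf r(k)$ for $1\le k\le m$. Define $\Phi^p_i(x):=\varphi_{\mu(i)}\big((x(ij))_{j\in\Lambda}\big)$. A trajectory is a configuration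 $x\in\{0,1\}^\Lambda$ with $x(i)=\Phi^p_i(x)$ for all $i$; there is a maximal trajectory $\overline X^p$ (pointwise above every trajectory). The density $\overline\rho(p):=\mathbb P[\overline X^p(i)=1]$ does not depend on $i$, and $p_{\rm c}:=\sup\{p\ge0:\overline\rho(p)>0\}$. $\mathrm{round}$ denotes rounding to the nearest integer (i.e. majority of three bits). *)

(* Defs.v *)
From mathcomp Require Import all_boot all_order all_algebra.
From mathcomp Require Import all_classical all_reals all_analysis.

Set Implicit Arguments.
Unset Strict Implicit.
Unset Printing Implicit Defensive.

Import Order.TTheory GRing.Theory Num.Theory.

Local Open Scope classical_set_scope.
Local Open Scope ring_scope.

Definition Z3 : Type := (int * int * int)%type.

Definition addZ3 (i j : Z3) : Z3 :=
  (i.1.1 + j.1.1, i.1.2 + j.1.2, i.2 + j.2).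

Definition originZ3 : Z3 := (0, 0, 0).

(* round((a+b+c)/3) for bits a b c, i.e. majority of three bits *)
Definition round3 (a b c : bool) : bool :=
  ((nat_of_bool a + nat_of_bool b + nat_of_bool c) >= 2)%N.

Definition phi_a (x : Z3 -> bool) : bool :=
  round3 (x (1, 0, 0)) (x (0, 1, 0)) (x (0, 0, 1)).

Definition phi_b (x : Z3 -> bool) : bool :=
  round3 (x (1, 0, -1)) (x (0, 1, -1)) (x (0, 0, -1)).

(* m = 1: mu(i) in {0,1}, encoded as a bool (true = 1, false = 0);
   phi_0 is the constant zero map. Phi_i(x) = phi_{mu(i)}((x(i j))_j). *)
Definition Phi (phi : (Z3 -> bool) -> bool) (mu : Z3 -> bool)
    (x : Z3 -> bool) (i : Z3) : bool :=
  if mu i then phi (fun j => x (addZ3 i j)) else false.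

Definition trajectory (phi : (Z3 -> bool) -> bool) (mu : Z3 -> bool)
    (x : Z3 -> bool) : Prop :=
  forall i, x i = Phi phi mu x i.

Definition maximal_trajectory (phi : (Z3 -> bool) -> bool) (mu : Z3 -> bool)
    (X : Z3 -> bool) : Prop :=
  trajectory phi mu X /\
  forall y, trajectory phi mu y -> forall i, (y i ==> X i).

Definition iid_field (R : realType) (d : measure_display)
    (T : measurableType d) (P : probability T R) (mu : Z3 -> T -> bool)
    (p : R) : Prop :=
  [/\ (forall i b, measurable [set w | mu i w = b]),
      (forall i, P [set w | mu i w = false] = p%:E) &
      (forall (s : seq Z3) (b : Z3 -> bool), uniq s ->
         P (\bigcap_(i in [set` s]) [set w | mu i w = b i]) =
         (\prod_(i <- s) P [set w | mu i w = b i])%E)].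

Definition top_event (phi : (Z3 -> bool) -> bool) (T : Type)
    (mu : Z3 -> T -> bool) : set T :=
  [set w | exists X, maximal_trajectory phi (fun i => mu i w) X /\ X originZ3].

(* rho_bar(p) > 0 (the density does not depend on the underlying
   probability space, so we require it on every such space). *)
Definition rho_pos (R : realType) (phi : (Z3 -> bool) -> bool) (p : R) : Prop :=
  forall (d : measure_display) (T : measurableType d) (P : probability T R)
         (mu : Z3 -> T -> bool),
    iid_field P mu p -> (0 < P (top_event phi mu))%E.

Definition p_crit (R : realType) (phi : (Z3 -> bool) -> bool) : R :=
  sup [set p : R | 0 <= p <= 1 /\ rho_pos phi p].

(* Main.v *)
From HB Require Import structures.
Require Import Defs.
From mathcomp Require Import all_boot all_order all_algebra.
From mathcomp Require Import all_classical all_reals all_analysis.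
From mathcomp Require Import zify ring lra.
Set Implicit Arguments.
Unset Strict Implicit.
Unset Printing Implicit Defensive.

Import Order.TTheory GRing.Theory Num.Theory.
Local Open Scope ring_scope.

(** Start the automaton of case (a) from the all-one configuration: the origin
    is [0] after finitely many steps iff the origin of the maximal trajectory
    is [0]. A non-defective zero has two zero children, so for each of the three
    charges [s] it has a zero child in a direction other than [s]; following
    such children a charge ends in a defect. Zeros are grouped into clusters,
    merged when they contain two children of the same site. By induction on
    merges, in every cluster the three charges of any sites extend to a tree of
    defects in which each new defect is reached from an earlier one by climbing
    a charge backwards, hopping to a sibling site and following another charge
    down. As the levels [L_s(i) = h(i) - 3 i_s] of a site sum to [0], each
    charge step raises its level by [1], and each merge loses at most [3], a tree
    with [n] defects has at most [3 (n - 1)] charge steps. A weighted count of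
    these trees shows that the origin is [0] with probability less than [1].
    Case (b) is the image of case (a) under a linear involution. *)

(** * Charges, levels and sibling sites *)

Inductive axis := A1 | A2 | A3.

Definition eqb_axis (s t : axis) :=
  match s, t with A1, A1 | A2, A2 | A3, A3 => true | _, _ => false end.

Lemma eqb_axisP : Equality.axiom eqb_axis.
Proof. by case=> [] []; constructor. Qed.

HB.instance Definition _ := hasDecEq.Build axis eqb_axisP.

Definition turn (s : axis) := match s with A1 => A2 | A2 => A3 | A3 => A1 end.
Definition others (s : axis) := [:: turn s; turn (turn s)].

Lemma in_others s t : (t \in others s) = (t != s).
Proof. by case: s; case: t. Qed.

Lemma other_two s0 s1 s2 : s0 != s1 -> s0 != s2 -> s1 != s2 ->
  (s1 = turn s0 /\ s2 = turn (turn s0)) \/ (s2 = turn s0 /\ s1 = turn (turn s0)).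
Proof.
by case: s0; case: s1; case: s2 => // _ _ _; first [by left | by right].
Qed.

Definition unit_vec (s : axis) : Z3 :=
  match s with A1 => (1, 0, 0) | A2 => (0, 1, 0) | A3 => (0, 0, 1) end.

Definition subZ3 (i j : Z3) : Z3 := (i.1.1 - j.1.1, i.1.2 - j.1.2, i.2 - j.2).

Definition neighbour (i : Z3) (s : axis) := addZ3 i (unit_vec s).

Lemma neighbourK i s : subZ3 (neighbour i s) (unit_vec s) = i.
Proof. by case: i => [[a b] c]; rewrite /subZ3 /= !addrK. Qed.

(* A step along [t] raises [level s] by [1] if [t != s] and lowers it by [2] if
   [t = s]; the three levels of a site sum to [0]. *)
Definition level (s : axis) (i : Z3) : int :=
  i.1.1 + i.1.2 + i.2 - 3 * match s with A1 => i.1.1 | A2 => i.1.2 | A3 => i.2 end.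

Lemma level_neighbour s i t : t != s -> level s (neighbour i t) = level s i + 1.
Proof. by case: i => [[a b] c]; case: s; case: t => // _; rewrite /level /=; lia. Qed.

Lemma sum_level i : level A1 i + level A2 i + level A3 i = 0.
Proof. by case: i => [[a b] c]; rewrite /level /=; lia. Qed.

Definition siblings (x y : Z3) :=
  exists w a b, [/\ a != b, x = neighbour w a & y = neighbour w b].

Lemma siblingsC x y : siblings x y -> siblings y x.
Proof. by case=> w [a [b [ab -> ->]]]; exists w, b, a; rewrite eq_sym. Qed.

(** The levels of the common parent sum to [0]. Only the charges [a] and [b] can lose [2] on the way
    to a child, and the third gains [1]. *)
Lemma siblings_level x y (side : axis -> bool) : siblings x y ->
  let q s := if side s then x else y in
  -3 <= level A1 (q A1) + level A2 (q A2) + level A3 (q A3).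
Proof.
case=> [[[w1 w2] w3]] [a [b [ab -> ->]]] /=.
by move: ab; case: a; case: b => // _; case: (side A1); case: (side A2);
  case: (side A3); rewrite /level /=; lia.
Qed.

(** * Enumeration of the trees of defects *)

(* The number of charge steps and the list of defects of an explored tree. *)
Definition outcome : Type := nat * seq Z3.
Definition idle : outcome := (0%N, [::]).
Definition pay (k : nat) (o : outcome) : outcome := ((k + o.1)%N, o.2).
Definition branch (v : Z3) (o o' : outcome) : outcome :=
  ((o.1 + o'.1)%N, v :: o.2 ++ o'.2).

(** A hop chooses the next charge and an ordered pair of distinct directions: up along the first,
    down along the second. These 12 choices enter the weighted count. *)
Definition hops (s : axis) : seq (axis * axis * axis) :=
  [seq (s', a, b) | s' <- others s,
     '(a, b) <- [:: (A1, A2); (A1, A3); (A2, A1); (A2, A3); (A3, A1); (A3, A2)]].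

Lemma in_hops s s' a b : s' != s -> a != b -> (s', a, b) \in hops s.
Proof. by case: s; case: s'; case: a; case: b. Qed.

Definition hop_end (m : axis * axis * axis) (v : Z3) : Z3 :=
  neighbour (subZ3 v (unit_vec m.1.2)) m.2.

(* Fuelled enumeration of the trees hanging below a charge [s] that descends from
   [v] ([fall]) or is climbed backwards from [v] ([climb]). In [fall], at a
   defect the other two charges are each either ignored or climbed. *)
Fixpoint fall (n : nat) (s : axis) (v : Z3) : seq outcome :=
  if n is n'.+1 then
    [seq pay 1 o | t <- others s, o <- fall n' s (neighbour v t)] ++
    [seq branch v o o' | o <- idle :: climb n' (turn s) v,
                         o' <- idle :: climb n' (turn (turn s)) v]
  else [::]
with climb (n : nat) (s : axis) (v : Z3) : seq outcome :=
  if n is n'.+1 then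
    [seq pay 1 o | t <- others s, o <- climb n' s (subZ3 v (unit_vec t))] ++
    [seq o | m <- hops s, o <- fall n' m.1.1 (hop_end m v)]
  else [::].

Lemma fallS n s v : fall n.+1 s v =
  [seq pay 1 o | t <- others s, o <- fall n s (neighbour v t)] ++
  [seq branch v o o' | o <- idle :: climb n (turn s) v,
                       o' <- idle :: climb n (turn (turn s)) v].
Proof. by []. Qed.

Lemma climbS n s v : climb n.+1 s v =
  [seq pay 1 o | t <- others s, o <- climb n s (subZ3 v (unit_vec t))] ++
  [seq o | m <- hops s, o <- fall n m.1.1 (hop_end m v)].
Proof. by []. Qed.

(** Extra fuel only adds trees; hence two subtrees at a defect can share one fuel, and the explored
    events increase. *)
Lemma explore_monoS n : (forall s v, {subset fall n s v <= fall n.+1 s v}) /\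
  (forall s v, {subset climb n s v <= climb n.+1 s v}).
Proof.
elim: n => [|n [IHf IHc]]; first by split.
have sub1 s v : {subset idle :: climb n s v <= idle :: climb n.+1 s v}.
  by move=> o; rewrite !inE => /orP[-> //|/IHc ->]; rewrite orbT.
split=> s v o.
- rewrite fallS mem_cat => /orP ho; rewrite fallS mem_cat; apply/orP; move: ho.
  case=> /allpairsPdep[t [u [ht ho ->]]]; [left|right];
    apply/allpairsPdep; exists t, u; split=> //; [exact: IHf|exact: sub1|exact: sub1].
- rewrite climbS mem_cat => /orP ho; rewrite climbS mem_cat; apply/orP; move: ho.
  case=> /allpairsPdep[t [u [ht ho ->]]]; [left|right];
    apply/allpairsPdep; exists t, u; split=> //; [exact: IHc|exact: IHf].
Qed.

Lemma fall_mono n m s v : (n <= m)%N -> {subset fall n s v <= fall m s v}.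
Proof.
move/subnK <-; elim: (m - n)%N => [//|k IH] o /IH.
exact: (explore_monoS _).1.
Qed.

Lemma climb_mono n m s v : (n <= m)%N -> {subset climb n s v <= climb m s v}.
Proof.
move/subnK <-; elim: (m - n)%N => [//|k IH] o /IH.
exact: (explore_monoS _).2.
Qed.

Definition falls s v o := exists n, o \in fall n s v.
Definition climbs s v o := exists n, o \in climb n s v.
Definition ports s v o := o = idle \/ climbs s v o.

Lemma falls_step s v t o : t != s -> falls s (neighbour v t) o -> falls s v (pay 1 o).
Proof.
move=> ts [n ho]; exists n.+1; rewrite ?fallS ?climbS mem_cat; apply/orP; left.
by apply/allpairsPdep; exists t, o; rewrite in_others.
Qed.

Lemma climbs_step s v t o : t != s -> climbs s v o -> climbs s (neighbour v t) (pay 1 o).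
Proof.
move=> ts [n ho]; exists n.+1; rewrite ?fallS ?climbS mem_cat; apply/orP; left.
by apply/allpairsPdep; exists t, o; rewrite in_others neighbourK.
Qed.

Lemma climbs_hop s s' x y o : s' != s -> siblings x y -> falls s' y o -> climbs s x o.
Proof.
move=> ss [w [a [b [ab -> ->]]]] [n ho]; exists n.+1; rewrite ?fallS ?climbS mem_cat.
apply/orP; right; apply/allpairsPdep; exists (s', a, b), o.
by rewrite in_hops // /hop_end neighbourK.
Qed.

Lemma falls_sink s v o o' : ports (turn s) v o -> ports (turn (turn s)) v o' ->
  falls s v (branch v o o').
Proof.
have portsE s' o1 : ports s' v o1 -> exists n, o1 \in idle :: climb n s' v.
  case=> [->|[n ho]]; first by exists 0%N; rewrite inE eqxx.
  by exists n; rewrite inE ho orbT.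
have subI n m s' : (n <= m)%N -> {subset idle :: climb n s' v <= idle :: climb m s' v}.
  by move=> nm o1; rewrite !inE => /orP[-> //|/(climb_mono nm)->]; rewrite orbT.
move=> /portsE[n ho] /portsE[m ho']; exists (maxn n m).+1.
rewrite fallS mem_cat; apply/orP; right; apply/allpairsPdep; exists o, o'.
by split=> //; [apply: subI ho; rewrite leq_maxl|apply: subI ho'; rewrite leq_maxr].
Qed.

(** * Descents of charges and grafting of trees *)

Inductive descent (s : axis) : nat -> Z3 -> Z3 -> Prop :=
| descent0 v : descent s 0 v v
| descentS k t v r : t != s -> descent s k (neighbour v t) r -> descent s k.+1 v r.

Lemma descent_level s k v r : descent s k v r -> level s r = level s v + k%:Z.
Proof.
elim=> {k v r} [v|k t v r ts _ ->]; first by rewrite addr0.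
by rewrite level_neighbour //; lia.
Qed.

Lemma falls_descent s k v r o : descent s k v r -> falls s r o -> falls s v (pay k o).
Proof.
elim=> {k v r} [v|k t v r ts _ IH] ho; first by rewrite /pay; case: o ho.
by move/(falls_step ts): (IH ho); rewrite /pay addnA.
Qed.

(** The descent is retraced from its end [r] up to [v], where [o] takes over. *)
Lemma climbs_descent s k v r o : descent s k v r -> climbs s v o -> climbs s r (pay k o).
Proof.
move=> d; elim: d o => {k v r} [v|k t v r ts _ IH] o ho.
  by rewrite /pay; case: o ho.
by move/(climbs_step ts): ho => /IH; rewrite /pay addnA addn1.
Qed.

(* Of the three charges ending at [r], any one can be the root of a tree on [D]
   to which further trees can be attached at the other two. *)
Definition tree (D : seq Z3) (c : nat) (r : axis -> Z3) :=
  forall (s0 s1 s2 : axis) f1 f2, s0 != s1 -> s0 != s2 -> s1 != s2 ->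
  ports s1 (r s1) f1 -> ports s2 (r s2) f2 ->
  exists o : outcome, [/\ falls s0 (r s0) o, (o.1 <= c + f1.1 + f2.1)%N &
                perm_eq o.2 (D ++ f1.2 ++ f2.2)].

Lemma tree_sink v : tree [:: v] 0 (fun=> v).
Proof.
move=> s0 s1 s2 f1 f2 n01 n02 n12 p1 p2.
(* [fall] lists the other two charges in cyclic order, so [f1] and [f2] may have to be exchanged. *)
case: (other_two n01 n02 n12) => -[E1 E2]; rewrite {}E1 {}E2 in p1 p2 *.
- exists (branch v f1 f2); split=> //; exact: falls_sink.
- exists (branch v f2 f1); split; first exact: falls_sink.
    by rewrite /= add0n addnC.
  by rewrite /= perm_cons perm_catC.
Qed.

(* The sites [x] and [y] belong to two merging clusters. A charge whose root lies
   in the first one ([side s]) needs an end in the second, reached from [y];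
   the other charges need one in the first, reached from [x]. *)
Section Graft.
Variables (D D' : seq Z3) (c c' : nat) (r r' : axis -> Z3) (x y : Z3).
Variables (side : axis -> bool) (k : axis -> nat).
Hypotheses (treeD : tree D c r) (treeD' : tree D' c' r') (xy : siblings x y).
Hypothesis descx : forall s, ~~ side s -> descent s (k s) x (r s).
Hypothesis descy : forall s, side s -> descent s (k s) y (r' s).

(** After the merge the ends [r s1] and [r' s0] are no longer roots, which frees them for the
    passage between the clusters: climb [s1] from [r s1] to [x], hop to [y], fall along [s0] to
    [r' s0], and continue with the tree on [D']. *)
Lemma graft_falls (s0 s1 s2 : axis) f1 f2 : s0 != s1 -> s0 != s2 -> s1 != s2 ->
  side s0 -> ~~ side s1 ->
  ports s1 (r' s1) f1 -> ports s2 (if side s2 then r s2 else r' s2) f2 ->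
  exists o : outcome, [/\ falls s0 (r s0) o,
    (o.1 <= c + c' + (k A1 + k A2 + k A3) + f1.1 + f2.1)%N &
    perm_eq o.2 (D ++ D' ++ f1.2 ++ f2.2)].
Proof.
move=> n01 n02 n12 side0 side1 p1 p2.
have kle : (k s0 + k s1 <= k A1 + k A2 + k A3)%N.
  by move: n01; case: (s0); case: (s1) => // _; lia.
(* The third charge is extended in the cluster that keeps its root and stays idle in the other. *)
pose h1 := if side s2 then f2 else idle.
pose h2 := if side s2 then idle else f2.
have ph1 : ports s2 (r s2) h1.
  by rewrite /h1; case: ifP p2 => // _ _; left.
have ph2 : ports s2 (r' s2) h2.
  by rewrite /h2; case: ifP p2 => // _ _; left.
have h12 : (h1.1 + h2.1)%N = f2.1 by rewrite /h1 /h2; case: ifP; rewrite ?addn0.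
have [w [fo' co' so']] := treeD' n01 n02 n12 p1 ph2.
have co : climbs s1 (r s1) (pay (k s1) (pay (k s0) w)).
  apply/(climbs_descent (descx side1)); apply: (climbs_hop n01 xy).
  exact: falls_descent (descy side0) fo'.
have [u [fo co1 so]] := treeD n01 n02 n12 (or_intror co) ph1.
exists u; split=> //.
  by move: co1 co' h12 kle => /=; clear; lia.
apply: (perm_trans so); rewrite perm_cat2l /=.
apply: (@perm_trans _ ((D' ++ f1.2 ++ h2.2) ++ h1.2)); first by rewrite perm_cat2r.
rewrite -!catA !perm_cat2l /h1 /h2; case: ifP => _; by rewrite ?cats0.
Qed.

End Graft.

(** Both sides occur, so [s1] or [s2] has its root in the cluster opposite to that of [s0] and can
    serve as the passage. *)
Lemma tree_graft D D' c c' r r' x y side k :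
  tree D c r -> tree D' c' r' -> siblings x y ->
  (forall s, ~~ side s -> descent s (k s) x (r s)) ->
  (forall s, side s -> descent s (k s) y (r' s)) ->
  (exists s, side s) -> (exists s, ~~ side s) ->
  tree (D ++ D') (c + c' + (k A1 + k A2 + k A3))
    (fun s => if side s then r s else r' s).
Proof.
move=> T T' xy dx dy [sl hl] [sr hr] s0 s1 s2 f1 f2 n01 n02 n12 p1 p2.
have dx' s : ~~ ~~ side s -> descent s (k s) y (r' s) by rewrite negbK; apply: dy.
have yx := siblingsC xy.
have pswap A B C : perm_eq (A ++ B ++ C) (A ++ C ++ B).
  by rewrite perm_cat2l perm_catC.
case h0: (side s0).
- have [/negbTE h1|h1] := boolP (~~ side s1).
    have [|u [fo co so]] :=
        graft_falls T T' xy dx dy n01 n02 n12 h0 (negbT h1) (f1 := f1) _ p2.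
      by rewrite h1 in p1.
    by exists u; rewrite -catA.
  have h2 : ~~ side s2.
    apply: contraNN hr => h2; move: h0 (negPn h1) h2 n01 n02 n12.
    by case: (s0); case: (s1); case: (s2) => // *; case: (sr).
  have n21 : s2 != s1 by rewrite eq_sym.
  have [|u [fo co so]] := graft_falls T T' xy dx dy n02 n01 n21 h0 h2 (f1 := f2) _ p1.
    by rewrite (negbTE h2) in p2.
  exists u; split=> //; first by move: co; lia.
  by rewrite -catA; apply: (perm_trans so); rewrite perm_cat2l.
(* The two clusters exchange roles: [side] is negated. *)
- have h0' : ~~ side s0 by rewrite h0.
  have fin o f f' : perm_eq o (D' ++ D ++ f ++ f') ->
      perm_eq o ((D ++ D') ++ f ++ f') /\ perm_eq o ((D ++ D') ++ f' ++ f).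
    move=> so; suff E : perm_eq o ((D ++ D') ++ f ++ f').
      by split=> //; apply: (perm_trans E).
    by apply: (perm_trans so); rewrite catA perm_cat2r perm_catC.
  have [h1|/negbTE h1] := boolP (side s1).
    have [|||u [fo co so]] := graft_falls (side := fun s => ~~ side s)
        T' T yx dx' dx n01 n02 n12 h0' _ _ (f1 := f1) (f2 := f2).
    + by rewrite h1.
    + by rewrite h1 in p1.
    + by move: p2; case: (side s2).
    exists u; split=> //; first by move: co; lia.
    by case: (fin _ _ _ so).
  have h2 : side s2.
    apply: contraTT hl => h2; move: h0 h1 (negbTE h2) n01 n02 n12.
    by case: (s0); case: (s1); case: (s2) => // *; apply/negbT; case: (sl).
  have n21 : s2 != s1 by rewrite eq_sym.
  have [|||u [fo co so]] := graft_falls (side := fun s => ~~ side s)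
      T' T yx dx' dx n02 n01 n21 h0' _ _ (f1 := f2) (f2 := f1).
  + by rewrite h2.
  + by rewrite h2 in p2.
  + by rewrite h1 in p1 *.
  exists u; split=> //; first by move: co; lia.
  by case: (fin _ _ _ so).
Qed.

(** * Contours of clusters and their step budget *)

(** The last clause is the budget. If the three charges start at one site, their end levels sum to
    [k A1 + k A2 + k A3], so all charge steps together number at most [3 (n - 1)] for [n]
    defects. *)
Definition contour (bad P : Z3 -> bool) (v : axis -> Z3)
    (D : seq Z3) (c : nat) (r : axis -> Z3) (k : axis -> nat) :=
  [/\ tree D c r, uniq D, {in D, forall d, P d && bad d},
      forall s, descent s (k s) (v s) (r s) &
      c%:Z + 3 <= 3 * (size D)%:Z
        - (level A1 (r A1) + level A2 (r A2) + level A3 (r A3))].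

Definition cluster (bad P : Z3 -> bool) :=
  forall v : axis -> Z3, (forall s, P (v s)) ->
  exists D c r k, contour bad P v D c r k.

Lemma cluster_sink (bad : Z3 -> bool) v : bad v -> cluster bad (pred1 v).
Proof.
move=> badv u uv; exists [:: v], 0%N, (fun=> v), (fun=> 0%N); split=> //.
- exact: tree_sink.
- by move=> d; rewrite inE => /eqP->; rewrite /= eqxx badv.
- by move=> s; rewrite (eqP (uv s)); constructor.
- by rewrite sum_level.
Qed.

Lemma contour_subset (bad P P' : Z3 -> bool) v D c r k : subpred P P' ->
  contour bad P v D c r k -> contour bad P' v D c r k.
Proof.
move=> sub [? ? PD ? ?]; split=> // d /PD /andP[/sub Pd bd]; exact/andP.
Qed.

Lemma contour_merge (bad P P' : Z3 -> bool) x y v side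
    D c r k D' c' r' k' :
  siblings x y -> (forall i, P i -> ~~ P' i) ->
  contour bad P (fun s => if side s then v s else x) D c r k ->
  contour bad P' (fun s => if side s then y else v s) D' c' r' k' ->
  (exists s, side s) -> (exists s, ~~ side s) ->
  let l s := if side s then k' s else k s in
  contour bad (predU P P') v (D ++ D') (c + c' + (l A1 + l A2 + l A3))
    (fun s => if side s then r s else r' s)
    (fun s => if side s then k s else k' s).
Proof.
move=> xy disj [T uD PD dD cD] [T' uD' PD' dD' cD'] exl exr l.
have lx s : ~~ side s -> descent s (l s) x (r s).
  by move=> /negbTE h; move: (dD s); rewrite /l h.
have ly s : side s -> descent s (l s) y (r' s).
  by move=> h; move: (dD' s); rewrite /l h.
split.
- exact: tree_graft xy lx ly exl exr.
- rewrite cat_uniq uD uD' andbT; apply/hasPn => d /PD'/andP[P'd _].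
  by apply/negP => /PD/andP[/disj]; rewrite P'd.
- move=> d; rewrite mem_cat => /orP[/PD|/PD'] /andP[h hb]; rewrite /= h hb ?orbT //.
- by move=> s; move: (dD s) (dD' s); case: (side s).
(* Adding both budgets leaves a spare [3], which covers the sibling loss; each descent to a
   discarded root pays for itself by the level it gains. *)
- have := siblings_level (fun s => ~~ side s) xy.
  have key s : level s (if side s then r s else r' s) =
      level s (r s) + level s (r' s) - (l s)%:Z - level s (if ~~ side s then x else y).
    have [h|h] := boolP (side s).
      by rewrite (descent_level (ly s h)) /=; lia.
    by rewrite (descent_level (lx s h)) /=; lia.
  rewrite !key size_cat /=; move: cD cD'; clear; lia.
Qed.

Lemma cluster_merge (bad P P' : Z3 -> bool) x y : P x -> P' y -> siblings x y ->
  (forall i, P i -> ~~ P' i) ->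
  cluster bad P -> cluster bad P' -> cluster bad (predU P P').
Proof.
move=> Px Py xy disj clP clP' v Pv.
have PvN s : ~~ P (v s) -> P' (v s) by move=> /negbTE h; move: (Pv s); rewrite /= h.
(* If all charges start in one cluster, its contour alone suffices. *)
have [exl|nol] := pselect (exists s, P (v s)); last first.
  have [|D [c [r [k C]]]] := clP' v.
    by move=> s; apply: PvN; apply/negP => h; apply: nol; exists s.
  by exists D, c, r, k; apply: contour_subset C => i /= ->; rewrite orbT.
have [exr|nor] := pselect (exists s, ~~ P (v s)); last first.
  have [|D [c [r [k C]]]] := clP v.
    by move=> s; apply: contrapT => /negP h; apply: nor; exists s.
  by exists D, c, r, k; apply: contour_subset C => i /= ->.
(* In each cluster, the charges that start in the other one are started at the merge site
   instead. *)
have [|D [c [r [k C]]]] := clP (fun s => if P (v s) then v s else x).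
  by move=> s; case: ifP.
have [|D' [c' [r' [k' C']]]] := clP' (fun s => if P (v s) then y else v s).
  by move=> s; case: ifPn => // /PvN.
do 4 eexists; exact: (contour_merge (side := fun s => P (v s)) xy disj C C' exl exr).
Qed.

(** A charge starting at [w] first steps to whichever of the two children is not in its own
    direction; the tree stays the same and only [k] grows. *)
Lemma cluster_add (bad P : Z3 -> bool) w a b : a != b ->
  P (neighbour w a) -> P (neighbour w b) ->
  cluster bad P -> cluster bad (predU1 w P).
Proof.
move=> ab Pa Pb clP v Pv.
pose u s := if v s == w then neighbour w (if s == a then b else a) else v s.
have [|D [c [r [k [T uD PD dD cD]]]]] := clP u.
  move=> s; move: (Pv s); rewrite /u /=; case: eqP => //= _ _; by case: ifP.
exists D, c, r, (fun s => if v s == w then (k s).+1 else k s); split=> //.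
- by move=> d /PD /andP[h hb]; rewrite /= h hb orbT.
- move=> s; move: (dD s); rewrite /u; case: eqP => // -> ds.
  by apply: descentS ds; case: (altP (s =P a)) => [->|]; rewrite eq_sym // eq_sym.
Qed.

(** * Partitions of a set of zeros into clusters *)

(** [g] labels each site of [Y] by its cluster. Labels lie in [Y], so a new site outside [Y] is a
    fresh label. *)
Definition clustering (bad Y : Z3 -> bool) (g : Z3 -> Z3) :=
  (forall i, Y i -> Y (g i)) /\
  forall l, cluster bad (fun i => Y i && (g i == l)).

Lemma clustering0 (bad : Z3 -> bool) g : clustering bad pred0 g.
Proof. by split=> // l v /(_ A1). Qed.

Lemma clustering_sink (bad Y : Z3 -> bool) g w : ~~ Y w -> bad w -> clustering bad Y g ->
  clustering bad (predU1 w Y) (fun i => if i == w then w else g i).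
Proof.
move=> Yw bw [Yg cl]; split=> [i /=|l].
  by case: (altP (i =P w)) => [_ _|_ /=]; rewrite ?eqxx // => /Yg ->; rewrite orbT.
have [<-|lw] := eqVneq w l.
  rewrite (_ : (fun _ => _) = pred1 w); first exact: cluster_sink.
  apply/funext => i /=; case: (altP (i =P w)) => [->|_ /=]; first by rewrite eqxx.
  by apply/negP => /andP[/Yg + /eqP E]; rewrite E (negbTE Yw).
rewrite (_ : (fun _ => _) = fun i => Y i && (g i == l)); first exact: cl.
apply/funext => i /=; case: (altP (i =P w)) => [->|//].
by rewrite (negbTE lw) (negbTE Yw).
Qed.

Lemma clustering_merge (bad Y : Z3 -> bool) g x y : Y x -> Y y -> siblings x y ->
  clustering bad Y g ->
  exists g', clustering bad Y g' /\ g' x = g' y.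
Proof.
move=> Yx Yy xy [Yg cl]; have [E|gxy] := eqVneq (g x) (g y); first by exists g.
exists (fun i => if g i == g y then g x else g i); split; last first.
  by rewrite eqxx (negbTE gxy).
split=> [i Yi|l]; first by case: ifP => _; apply: Yg.
have [->|lx] := eqVneq l (g x).
  rewrite (_ : (fun _ => _) =
    predU (fun i => Y i && (g i == g x)) (fun i => Y i && (g i == g y))).
    apply: (cluster_merge _ _ xy) => //; rewrite ?Yx ?Yy ?eqxx //.
    by move=> i /andP[_ /eqP->]; rewrite negb_and gxy orbT.
  apply/funext => i /=; rewrite -andb_orr; congr (_ && _).
  by case: (altP (g i =P g y)); rewrite ?eqxx ?orbT ?orbF.
have [->|ly] := eqVneq l (g y).
  rewrite (_ : (fun _ => _) = pred0); first by move=> v /(_ A1).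
  apply/funext => i /=; case: (altP (g i =P g y)) => [_|/negbTE ->].
    by rewrite (negbTE gxy) andbF.
  by rewrite andbF.
rewrite (_ : (fun _ => _) = fun i => Y i && (g i == l)); first exact: cl.
apply/funext => i; congr (_ && _); case: (altP (g i =P g y)) => // ->.
by rewrite ![_ == l]eq_sym (negbTE lx) (negbTE ly).
Qed.

(** The clusters of the two children are merged first, so that [w] joins a single cluster. *)
Lemma clustering_add (bad Y : Z3 -> bool) g w a b : ~~ Y w -> a != b ->
  Y (neighbour w a) -> Y (neighbour w b) -> clustering bad Y g ->
  exists g', clustering bad (predU1 w Y) g'.
Proof.
move=> Yw ab Ya Yb clY.
have sib : siblings (neighbour w a) (neighbour w b) by exists w, a, b.
have [g1 [[Yg cl] gab]] := clustering_merge Ya Yb sib clY.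
pose h i := if i == w then g1 (neighbour w a) else g1 i.
exists h; split=> [i /= hi|l].
  rewrite /h; case: (altP (i =P w)) hi => /= [_ _|_ /Yg ->]; last by rewrite orbT.
  by rewrite Yg ?orbT.
have [<-|la] := eqVneq (g1 (neighbour w a)) l.
  rewrite (_ : (fun _ => _) =
    predU1 w (fun i => Y i && (g1 i == g1 (neighbour w a)))).
    by apply: (cluster_add ab) => //=; rewrite ?Ya ?Yb ?gab eqxx.
  by apply/funext => i; rewrite /= /h; case: (altP (i =P w)) => //= _; rewrite eqxx.
rewrite (_ : (fun _ => _) = fun i => Y i && (g1 i == l)); first exact: cl.
apply/funext => i; rewrite /= /h; case: (altP (i =P w)) => [->|//].
by rewrite (negbTE la) (negbTE Yw).
Qed.

(** * From a zero of the automaton to a witness tree *)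

Fixpoint flow (phi : (Z3 -> bool) -> bool) (mu : Z3 -> bool) (n : nat) (i : Z3) :=
  if n is n'.+1 then Phi phi mu (flow phi mu n') i else true.

Lemma round3_false a b c : ~~ round3 a b c ->
  [\/ ~~ a /\ ~~ b, ~~ a /\ ~~ c | ~~ b /\ ~~ c].
Proof.
by case: a; case: b; case: c => //= _;
  [apply: Or33 | apply: Or32 | apply: Or31 | apply: Or31].
Qed.

(** [Y] and [g] are arbitrary because the two zero children are explored in turn, the second on top
    of the clustering left by the first. *)
Lemma flow_clustering mu n i : ~~ flow phi_a mu n i ->
  forall Y g, clustering (predC mu) Y g ->
  exists Y' g', [/\ clustering (predC mu) Y' g', subpred Y Y' & Y' i].
Proof.
elim: n i => [//|n IH] i; rewrite /= /Phi => h Y g cl.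
have [Yi|nYi] := boolP (Y i); first by exists Y, g; split=> // j.
case: ifPn h => [_|mui _]; last first.
  exists (predU1 i Y), (fun j => if j == i then i else g j); split.
  - exact: clustering_sink.
  - by move=> j /= ->; rewrite orbT.
  - by rewrite /= eqxx.
have two a b : a != b -> ~~ flow phi_a mu n (neighbour i a) ->
    ~~ flow phi_a mu n (neighbour i b) ->
    exists Y' g', [/\ clustering (predC mu) Y' g', subpred Y Y' & Y' i].
  move=> ab /IH/(_ _ _ cl)[Y1 [g1 [cl1 sub1 Y1a]]].
  move=> /IH/(_ _ _ cl1)[Y2 [g2 [cl2 sub2 Y2b]]].
  have sub02 j : Y j -> Y2 j by move=> /sub1/sub2.
  have [Y2i|nY2i] := boolP (Y2 i); first by exists Y2, g2; split.
  have [g3 cl3] := clustering_add nY2i ab (sub2 _ Y1a) Y2b cl2.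
  exists (predU1 i Y2), g3; split=> // [j /sub02 /= ->|/=]; by rewrite ?orbT ?eqxx.
by case/round3_false => -[]; [exact: (two A1 A2)|exact: (two A1 A3)|exact: (two A2 A3)].
Qed.

Definition witness (mu : Z3 -> bool) (o : outcome) :=
  [&& uniq o.2, all (predC mu) o.2 & (o.1 + 3 <= 3 * size o.2)%N].

Lemma flow_witness mu n i : ~~ flow phi_a mu n i ->
  exists o, falls A1 i o /\ witness mu o.
Proof.
move=> /flow_clustering /(_ _ _ (clustering0 _ id)) [Y [g [[Yg cl] _ Yi]]].
(* All three charges start at [i], which turns the budget into the bound of [witness]; only [A1] is
   followed, the other two stay idle. *)
have [|D [c [r [k [T uD PD dD cD]]]]] := cl (g i) (fun=> i).
  by move=> s; rewrite Yi eqxx.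
have [//|//|//|||u [fu cu su]] := T A1 A2 A3 idle idle; try by left.
rewrite !cats0 in su.
have sz : size u.2 = size D := perm_size su.
exists (pay (k A1) u); split; first exact: falls_descent (dD A1) fu.
rewrite /witness /= (perm_uniq su) uD (perm_all _ su) sz /=.
apply/andP; split; first by apply/allP => d /PD /andP[].
move: cD cu (sum_level i); rewrite !(descent_level (dD _)) /idle /=; clear; lia.
Qed.

Local Open Scope classical_set_scope.

(** * Weighted count of the trees *)

Section Weight.
Variable R : realType.

(* With [edge = 3/10] and [p = 1/12000], a sink costs [p / edge ^ 3 = 1/324]; the
   potentials [1/50] of a fall and [3/5] of a climb satisfy
   [1/50 >= 2 edge / 50 + (1 + 3/5) ^ 2 / 324] and [3/5 >= 2 edge * 3/5 + 12 / 50]. *)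
Definition edge : R := 3 / 10.
Definition sink : R := 1 / 324.

Definition weight (o : outcome) : R := edge ^+ o.1 * sink ^+ size o.2.

Lemma weight_ge0 o : 0 <= weight o.
Proof. by rewrite mulr_ge0 ?exprn_ge0 // /edge /sink; lra. Qed.

Lemma sum_weight_pay (s : seq outcome) :
  \sum_(o <- s) weight (pay 1 o) = edge * \sum_(o <- s) weight o.
Proof.
by rewrite mulr_sumr; apply: eq_bigr => o _; rewrite /weight /= exprD expr1 mulrA.
Qed.

Lemma sum_weight_branch v (s t : seq outcome) :
  \sum_(o <- s) \sum_(o' <- t) weight (branch v o o') =
  sink * (\sum_(o <- s) weight o) * (\sum_(o' <- t) weight o').
Proof.
rewrite -mulrA mulr_suml mulr_sumr; apply: eq_bigr => o _.
rewrite !mulr_sumr; apply: eq_bigr => o' _.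
by rewrite /weight /= size_cat exprS !exprD; ring.
Qed.

Lemma sum_weight_explore n :
  (forall s v, \sum_(o <- fall n s v) weight o <= 1 / 50) /\
  (forall s v, \sum_(o <- climb n s v) weight o <= 3 / 5).
Proof.
elim: n => [|n [IHf IHc]]; first by split=> s v; rewrite big_nil; lra.
(* The idle outcome has weight [1], whence [8 / 5 = 1 + 3 / 5]. *)
have port s v : 0 <= \sum_(o <- idle :: climb n s v) weight o <= 8 / 5.
  rewrite sumr_ge0 => [|o _]; last exact: weight_ge0.
  by rewrite big_cons /weight /= !expr0 mulr1; have := IHc s v; rewrite /weight; lra.
split=> s v.
- rewrite fallS big_cat !big_allpairs_dep /= sum_weight_branch.
  rewrite big_cons big_seq1 !sum_weight_pay.
  have h1 := IHf s (neighbour v (turn s)); have h2 := IHf s (neighbour v (turn (turn s))).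
  have /andP[p1 q1] := port (turn s) v; have /andP[p2 q2] := port (turn (turn s)) v.
  have h3 := ler_pM p1 p2 q1 q2.
  rewrite -mulrA; move: h1 h2 h3; rewrite /edge /sink; clear; lra.
- rewrite climbS.
  have szh : size (hops s) = 12%N by case: (s).
  move: (hops s) szh => hs szh.
  rewrite big_cat !big_allpairs_dep /=.
  rewrite big_cons big_seq1 !sum_weight_pay.
  have h1 := IHc s (subZ3 v (unit_vec (turn s))).
  have h2 := IHc s (subZ3 v (unit_vec (turn (turn s)))).
  have h3 : \sum_(m <- hs) \sum_(o <- fall n m.1.1 (hop_end m v)) weight o <=
      \sum_(m <- hs) (1 / 50 : R).
    by apply: ler_sum => m _; apply: IHf.
  rewrite big_const_seq count_predT szh iter_addr addr0 -(mulr_natr (1 / 50)) in h3.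
  move: h1 h2 h3; rewrite /edge; clear; lra.
Qed.

End Weight.

(** * Union bound over the witness trees *)

Section Probability.
Context (R : realType) (d : measure_display) (T : measurableType d).
Variables (P : probability T R) (mu : Z3 -> T -> bool).

Lemma all_bad_measure p (s : seq Z3) : iid_field P mu p -> uniq s ->
  measurable [set w | all (predC (mu^~ w)) s] /\
  P [set w | all (predC (mu^~ w)) s] = (p ^+ size s)%:E.
Proof.
move=> [mmu Pp indep] us.
have E : [set w | all (predC (mu^~ w)) s] =
    \bigcap_(i in [set` s]) [set w | mu i w = false].
  apply/seteqP; split=> w /= h; first by move=> i /(allP h)/= /negbTE.
  by apply/allP => i /h /= ->.
split.
  by rewrite E; apply: fin_bigcap_measurable => // i _; apply: mmu.
rewrite E (indep s (fun=> false) us).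
elim: s {us E} => [|i s IH]; first by rewrite big_nil.
by rewrite big_cons IH Pp -EFinM exprS.
Qed.

(** With [n] defects, [p ^ n = edge ^ (3 n) * sink ^ n], and a witness has [o.1 + 3 <= 3 n] with
    [edge <= 1]. *)
Lemma witness_measure (o : outcome) : iid_field P mu (1 / 12000) ->
  measurable [set w | witness (mu^~ w) o] /\
  (P [set w | witness (mu^~ w) o] <= (edge R ^+ 3 * weight R o)%:E)%E.
Proof.
move=> iid; have e01 : 0 <= edge R <= 1 by rewrite /edge; lra.
have ge0 : 0 <= edge R ^+ 3 * weight R o.
  by rewrite mulr_ge0 ?weight_ge0 // exprn_ge0 //; case/andP: e01.
have [uo|nuo] := boolP (uniq o.2 && (o.1 + 3 <= 3 * size o.2)%N); last first.
  rewrite (_ : [set _ | _] = set0); first by rewrite measure0 lee_fin.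
  by apply/seteqP; split=> w //= /and3P[u1 _ u2]; rewrite u1 u2 in nuo.
case/andP: uo => uo co.
have [mo Po] := all_bad_measure iid uo.
rewrite (_ : [set _ | _] = [set w | all (predC (mu^~ w)) o.2]); last first.
  by apply/seteqP; split=> w /=; rewrite /witness uo co andbT.
split=> //; rewrite Po lee_fin /weight mulrA -exprD.
have -> : (1 / 12000 : R) = edge R ^+ 3 * sink R by rewrite /edge /sink; field.
rewrite exprMn -exprM ler_wpM2r //; first by rewrite exprn_ge0 // /sink; lra.
by rewrite ler_wiXn2l ?(andP e01).1 ?(andP e01).2 // addnC.
Qed.

Lemma has_witness_measure (s : seq outcome) : iid_field P mu (1 / 12000) ->
  measurable [set w | has (witness (mu^~ w)) s] /\
  (P [set w | has (witness (mu^~ w)) s] <=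
     (edge R ^+ 3 * \sum_(o <- s) weight R o)%:E)%E.
Proof.
move=> iid; elim: s => [|u s [ms Ps]].
  rewrite (_ : [set _ | _] = set0); last by apply/seteqP; split.
  by rewrite measure0 big_nil mulr0.
have [mo Po] := witness_measure u iid.
rewrite (_ : [set _ | _] =
    [set w | witness (mu^~ w) u] `|` [set w | has (witness (mu^~ w)) s]); last first.
  by apply/seteqP; split=> w /=; [move/orP|move=> h; apply/orP].
split; first exact: measurableU.
rewrite big_cons mulrDr EFinD.
by apply: (le_trans (measureU2 P mo ms)); apply: leeD.
Qed.

Definition explored (n : nat) : set T :=
  [set w | has (witness (mu^~ w)) (fall n A1 originZ3)].

Lemma explored_measure : iid_field P mu (1 / 12000) ->
  measurable (\bigcup_n explored n) /\
  (P (\bigcup_n explored n) <= (1 / 1000)%:E)%E.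
Proof.
move=> iid.
have mE n : measurable (explored n).
  by case: (has_witness_measure (fall n A1 originZ3) iid).
have mU : measurable (\bigcup_n explored n) by exact: bigcup_measurable.
split=> //.
(* The measure of the union is the limit along increasing fuel, so a bound uniform in [n]
   suffices. *)
have nd : nondecreasing_seq explored.
  move=> m n mn; apply/subsetPset => w /= /hasP[u hu wu]; apply/hasP; exists u => //.
  exact: fall_mono hu.
have cv := nondecreasing_cvg_mu (mu := P) mE mU nd.
rewrite -(cvg_lim _ cv) //; apply: lime_le; first by apply/cvg_ex; eexists; exact: cv.
apply: nearW => n /=.
apply: le_trans (has_witness_measure (fall n A1 originZ3) iid).2 _.
rewrite lee_fin; have := (sum_weight_explore R n).1 A1 originZ3.
(* The bound is [edge ^ 3 / 50 = 0.00054]. *)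
by rewrite /edge; lra.
Qed.

End Probability.

(** * The maximal trajectory as the limit of the flow *)

Lemma round3_mono (a b c a' b' c' : bool) : (a -> a') -> (b -> b') -> (c -> c') ->
  round3 a b c -> round3 a' b' c'.
Proof.
have le_b (x y : bool) : (x -> y) -> (x <= y)%N by case: x => // ->.
by move=> /le_b ha /le_b hb /le_b hc h; apply: leq_trans h _; rewrite !leq_add.
Qed.

Lemma flow_decreasing mu n m i : (m <= n)%N -> flow phi_a mu n i -> flow phi_a mu m i.
Proof.
elim: m n i => [//|m IH] [//|n] i mn; rewrite /= /Phi; case: (mu i) => //.
by apply: round3_mono; apply: IH.
Qed.

Lemma trajectory_le_flow mu y n i : trajectory phi_a mu y -> y i -> flow phi_a mu n i.
Proof.
move=> ty; elim: n i => [//|n IH] i; rewrite (ty i) /= /Phi; case: (mu i) => //.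
by apply: round3_mono; apply: IH.
Qed.

(** The flow decreases in time and dominates every trajectory. Its limit is a trajectory since two
    zero children in the limit are both zero from some common time on. *)
Lemma flow_maximal mu :
  maximal_trajectory phi_a mu (fun i => `[< forall n, flow phi_a mu n i >]).
Proof.
split; last first.
  move=> y ty i; apply/implyP => yi; apply/asboolP => n.
  exact: trajectory_le_flow ty yi.
move=> i; rewrite /Phi; apply/asboolP/idP => [h|].
  have := h 1%N; rewrite /= /Phi; case: ifP => // mui _.
  apply: contrapT => /negP hX.
  have two a b : ~~ `[< forall n, flow phi_a mu n a >] ->
      ~~ `[< forall n, flow phi_a mu n b >] ->
      exists n, ~~ flow phi_a mu n a /\ ~~ flow phi_a mu n b.
    move=> /asboolPn/existsNP[n /negP na] /asboolPn/existsNP[m /negP mb].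
    exists (maxn n m); split.
      by apply: contraNN na; apply: flow_decreasing; rewrite leq_maxl.
    by apply: contraNN mb; apply: flow_decreasing; rewrite leq_maxr.
  case/round3_false: hX => -[/two + /[dup] hb] => /(_ _ hb)[n [ha hb']];
    by have := h n.+1; rewrite /= /Phi mui /phi_a /round3 (negbTE ha) (negbTE hb');
      case: (flow _ _ _ _).
case: ifP => // mui h [//|n]; rewrite /= /Phi mui; apply: round3_mono h;
  by move=> /asboolP.
Qed.

Lemma top_event_flow (T : Type) (mu : Z3 -> T -> bool) :
  top_event phi_a mu = [set w | forall n, flow phi_a (mu^~ w) n originZ3].
Proof.
apply/seteqP; split=> w /=.
  by move=> [X [[tX _] X0]] n; apply: trajectory_le_flow tX X0.
move=> h; exists (fun i => `[< forall n, flow phi_a (mu^~ w) n i >]).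
by split; [exact: flow_maximal|exact/asboolP].
Qed.

Lemma measurable_flow d (T : measurableType d) (mu : Z3 -> T -> bool) n i :
  (forall j b, measurable [set w | mu j w = b]) ->
  measurable [set w | flow phi_a (mu^~ w) n i].
Proof.
move=> mmu; elim: n i => [|n IH] i.
  by rewrite (_ : [set _ | _] = setT) //; apply/seteqP; split.
pose F s := [set w | flow phi_a (mu^~ w) n (neighbour i s)].
rewrite (_ : [set _ | _] = [set w | mu i w = true] `&`
    ((F A1 `&` F A2) `|` (F A1 `&` F A3) `|` (F A2 `&` F A3))).
  by apply: measurableI => //; do ! apply: measurableU; apply: measurableI; apply: IH.
apply/seteqP; split=> w; rewrite /F /= /Phi /phi_a /round3 /neighbour /unit_vec;
  case: (mu i w) => //; case: (flow _ _ _ _); case: (flow _ _ _ _);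
  case: (flow _ _ _ _) => //=; tauto.
Qed.

Lemma measurable_top_event d (T : measurableType d) (mu : Z3 -> T -> bool) :
  (forall j b, measurable [set w | mu j w = b]) -> measurable (top_event phi_a mu).
Proof.
move=> mmu; rewrite top_event_flow.
rewrite (_ : [set _ | _] = \bigcap_n [set w | flow phi_a (mu^~ w) n originZ3]).
  by apply: bigcapT_measurable => n; apply: measurable_flow.
by apply/seteqP; split=> w h n; [move=> _; apply: h|apply: h].
Qed.

(** Outside the top event some witness is explored, which has probability at most [1 / 1000]. *)
Lemma top_event_gt0 (R : realType) d (T : measurableType d) (P : probability T R)
    (mu : Z3 -> T -> bool) : iid_field P mu (1 / 12000) ->
  (0 < P (top_event phi_a mu))%E.
Proof.
move=> iid; have [mE PE] := explored_measure iid.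
have mtop := measurable_top_event (let: And3 m _ _ := iid in m).
have sub : setT `<=` top_event phi_a mu `|` \bigcup_n explored mu n.
  move=> w _; have [h|h] := pselect (forall n, flow phi_a (mu^~ w) n originZ3).
    by left; rewrite top_event_flow.
  right; move/existsNP: h => [n /negP/flow_witness[u [[m um] wu]]].
  by exists m => //; apply/hasP; exists u.
have : (P setT <= P (top_event phi_a mu `|` \bigcup_n explored mu n))%E.
  by apply: le_measure; rewrite ?inE //; exact: measurableU.
rewrite probability_setT ltNge => h1; apply/negP => h0.
have := le_trans h1 (le_trans (measureU2 P mtop mE) (leeD h0 PE)).
by rewrite add0e lee_fin; lra.
Qed.

(** * Reduction of case (b) to case (a) *)

(* Carries the three unit vectors to (1,0,-1), (0,1,-1) and (0,0,-1). *)
Definition shear (i : Z3) : Z3 := (i.1.1, i.1.2, - i.1.1 - i.1.2 - i.2).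

Lemma shearK : involutive shear.
Proof. by case=> [[a b] c]; rewrite /shear /=; congr (_, _, _); ring. Qed.

Lemma shearD i j : shear (addZ3 i j) = addZ3 (shear i) (shear j).
Proof.
by case: i j => [[a b] c] [[a' b'] c']; rewrite /shear /addZ3 /=; congr (_, _, _); ring.
Qed.

Lemma Phi_shear mu X i :
  Phi phi_b mu X (shear i) = Phi phi_a (mu \o shear) (X \o shear) i.
Proof. by rewrite /Phi /phi_a /phi_b /= !shearD. Qed.

Lemma trajectory_shear mu X :
  trajectory phi_b mu X <-> trajectory phi_a (mu \o shear) (X \o shear).
Proof.
split=> tX i; first by rewrite -Phi_shear -tX.
by rewrite -[i]shearK Phi_shear -tX.
Qed.

Lemma maximal_trajectory_shear mu X :
  maximal_trajectory phi_b mu X <->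
  maximal_trajectory phi_a (mu \o shear) (X \o shear).
Proof.
have shear2 y : (y \o shear) \o shear = y :> (Z3 -> bool).
  by apply/funext => i /=; rewrite shearK.
split=> -[tX mX]; split; rewrite ?trajectory_shear //.
- by rewrite -trajectory_shear.
- move=> y ty i; have := mX (y \o shear).
  by rewrite trajectory_shear shear2 => /(_ ty (shear i)); rewrite /= shearK.
- move=> y ty i; have := mX (y \o shear).
  by rewrite -trajectory_shear => /(_ ty (shear i)); rewrite /= shearK.
Qed.

Lemma top_event_shear (T : Type) (mu : Z3 -> T -> bool) :
  top_event phi_b mu = top_event phi_a (mu \o shear).
Proof.
apply/seteqP; split=> w [X [mX X0]]; exists (X \o shear); split=> //.
  exact: (maximal_trajectory_shear (mu^~ w) X).1 mX.
apply: (maximal_trajectory_shear (mu^~ w) (X \o shear)).2.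
rewrite (_ : (X \o shear) \o shear = X) //.
by apply/funext => i /=; rewrite shearK.
Qed.

Lemma iid_field_shear (R : realType) d (T : measurableType d) (P : probability T R)
    (mu : Z3 -> T -> bool) p : iid_field P mu p -> iid_field P (mu \o shear) p.
Proof.
move=> [mmu Pp indep]; split=> [i b|i|s b us]; [exact: mmu|exact: Pp|].
(* A bijection of the sites preserves independence: the hypothesis is used at the image sites with
   the pulled-back values. *)
have := indep (map shear s) (b \o shear); rewrite map_inj_uniq; last first.
  exact: inv_inj shearK.
move=> /(_ us); rewrite big_map /=.
under eq_bigr do rewrite shearK; move=> <-; congr (P _).
apply/seteqP; split=> w /= h i hi.
  by move/mapP: hi => [j hj ->]; rewrite /= shearK; apply: h.
by have := h (shear i) (map_f shear hi); rewrite /= shearK.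
Qed.

(** * The bound on the critical parameter *)

Lemma p_crit_ge (R : realType) phi (p : R) : 0 <= p <= 1 -> rho_pos phi p ->
  p <= p_crit R phi.
Proof.
move=> p01 rp; apply: ub_le_sup; last by split.
(* The bound [1] makes [sup] a genuine supremum. *)
by exists 1 => q /= [/andP[]].
Qed.

Theorem theorem1 (R : realType) :
  (1 / 12000 : R) <= p_crit R phi_a /\ (1 / 12000 : R) <= p_crit R phi_b.
Proof.
have p01 : 0 <= (1 / 12000 : R) <= 1 by lra.
split; apply: p_crit_ge => // d T P mu iid; first exact: top_event_gt0.
by rewrite top_event_shear; apply: top_event_gt0; apply: iid_field_shear.
Qed.
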